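(* Let $a_1,a_2,a_3,a_4\in\mathbb R$ with $a_1a_4=a_2a_3$. The almost contact metric $5$-manifold $M^5(a_1,a_2,a_3,a_4)$ is of class $\mathcal W_4\oplus\mathcal W_7$. Moreover, it is of class $\mathcal W_4$ if and only if $a_3=a_4=0$, and of class $\mathcal W_7$ if and only if $a_1=a_2=0$.
   Context: An almost contact metric structure on a Riemannian $5$-manifold $(M^5,g)$ is a triple $(\xi,\eta,\varphi)$: a unit vector field $\xi$, its dual $1$-form $\eta$, and an endomorphism $\varphi$ of $TM^5$ with $\varphi(\xi)=0$, $\varphi^2=-\mathrm{Id}+\eta\otimes\xi$, $g(\varphi(X),\varphi(Y))=g(X,Y)-\eta(X)\eta(Y)$. Its fundamental form is $\Phi(X,Y):=g(X,\varphi(Y))$. An adapted frame is an oriented orthonormal frame $(e_1,\dots,e_5)$ with $\Phi=e_1\wedge e_2+e_3\wedge e_4$, $\eta=e_5$ ($TM^5$ is identified with its dual via $g$); adapted frames fix the orientation. $\nabla^g$ is the Levi-Civita connection. Classes. Identify $\mathfrak{so}(5)$ with $\Lambda^2$. With $\ast$ the Hodge operator, $\Lambda^2=\Lambda^2_1\oplus\Lambda^2_2\oplus\Lambda^2_3\oplus\Lambda^2_4$, where $\Lambda^2_1=\{t\Phi\mid t\in\mathbb R\}$, $\Lambda^2_2=\{\beta\mid\Phi\wedge\beta=0,\ \ast\beta=\eta\wedge\beta\}$, $\Lambda^2_3=\{\beta\mid\ast\beta=-\eta\wedge\beta\}$, $\Lambda^2_4=\{\beta\mid\eta\wedge\beta=0\}$;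 then $\mathfrak u(2)=\Lambda^2_1\oplus\Lambda^2_3$ and $\mathfrak u(2)^\perp=\Lambda^2_2\oplus\Lambda^2_4$. With $\omega^g_{ij}=g(\nabla^ge_i,e_j)$ for an adapted frame and $\Omega^g=(\omega^g_{ij})$, the intrinsic torsion is $\Gamma(X):=\mathrm{pr}_{\mathfrak u(2)^\perp}(\Omega^g(X))$, a section of $\mathcal W:=\Lambda^1\otimes\mathfrak u(2)^\perp$, regarded as a $(3,0)$-tensor skew in its last two arguments. Let $\theta(\beta)(X,Y,Z):=\ast\beta(X,Y,Z)$ and $\vartheta(\beta)(X,Y,Z):=3\,\eta(X)\beta(Y,Z)-\ast\beta(X,Y,Z)$ for $\beta\in\Lambda^2$. Then $\mathcal W_4=\theta(\Lambda^2_2)\subset\mathcal W$ and $\mathcal W_7=\vartheta(\Lambda^2_2)\subset\mathcal W$. The manifold is of class $\mathcal W_4\oplus\mathcal W_7$ (resp. $\mathcal W_4$, $\mathcal W_7$) if $\Gamma$ takes values in that subspace at every point. Construction of $M^5(a_1,a_2,a_3,a_4)$. Let $a_1a_4=a_2a_3$ and $\alpha:=-2\big((a_1-a_3)(2a_1+a_3)+(a_2-a_4)(2a_2+a_4)\big)$. There is a $6$-dimensional Lie group $G(a_1,a_2,a_3,a_4)$ with a basis $e_1,\dots,e_5,A_2$ of its left invariant $1$-forms satisfying $$\begin{aligned} de_1&=A_2\wedge e_2-(2a_1+a_3)e_3\wedge e_5-(2a_2+a_4)e_4\wedge e_5,\\ de_2&=-A_2\wedge e_1+(2a_1+a_3)e_4\wedge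 e_5-(2a_2+a_4)e_3\wedge e_5,\\ de_3&=-A_2\wedge e_4+(2a_1+a_3)e_1\wedge e_5+(2a_2+a_4)e_2\wedge e_5,\\ de_4&=A_2\wedge e_3-(2a_1+a_3)e_2\wedge e_5+(2a_2+a_4)e_1\wedge e_5,\\ de_5&=-2(a_1-a_3)(e_1\wedge e_3-e_2\wedge e_4)-2(a_2-a_4)(e_1\wedge e_4+e_2\wedge e_3),\\ dA_2&=\alpha\,(e_1\wedge e_2-e_3\wedge e_4). \end{aligned}$$ Let $M^5$ be a ($5$-dimensional) submanifold of $G(a_1,a_2,a_3,a_4)$ on which the restrictions of $e_1,\dots,e_5$ are linearly independent. $M^5(a_1,a_2,a_3,a_4)$ is $M^5$ with the Riemannian metric and almost contact metric structure for which $(e_1,\dots,e_5)$ is an adapted frame. *)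

(* Defs.v *)
From mathcomp Require Export all_boot all_order all_algebra.
From mathcomp Require Export all_classical all_reals all_analysis.
Export numFieldNormedType.Exports.

Set Implicit Arguments.
Unset Strict Implicit.
Unset Printing Implicit Defensive.

Import Order.TTheory GRing.Theory Num.Theory.
Local Open Scope classical_set_scope.
Local Open Scope ring_scope.

Section SmoothFunctions.
Context {R : realType} {V W : normedModType R}.

Fixpoint iter_derive (s : seq V) (f : V -> W) : V -> W :=
  if s is v :: s' then fun x => 'D_v (iter_derive s' f) x else f.

(* C^oo on the open set U: all iterated directional derivatives exist and are
   (Frechet) differentiable, hence continuous, at every point of U. *)
Definition smooth_on (U : set V) (f : V -> W) : Prop :=
  forall (s : seq V) (x : V), U x -> differentiable (iter_derive s f) x.

End SmoothFunctions.

(* A chart is given by its domain, the coordinate map and its inverse; both maps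
   are total functions, with irrelevant values off cdom and off its image. *)
Record manifold (R : realType) (n : nat) := Manifold {
  mcarrier :> topologicalType;
  mchart : Type;
  cdom : mchart -> set mcarrier;
  cmap : mchart -> mcarrier -> 'rV[R]_n;
  cinv : mchart -> 'rV[R]_n -> mcarrier;
  chart_at : mcarrier -> mchart;
  mfd_hausdorff : hausdorff_space mcarrier;
  mfd_second_countable : @second_countable mcarrier;
  chart_at_dom : forall p, cdom (chart_at p) p;
  cdom_open : forall c, open (cdom c);
  cimg_open : forall c, open (cmap c @` cdom c);
  cmapK : forall c p, cdom c p -> cinv c (cmap c p) = p;
  cmap_continuous : forall c, {within cdom c, continuous (cmap c)};
  cinv_continuous : forall c, {within cmap c @` cdom c, continuous (cinv c)};
  transition_smooth : forall c c',
    smooth_on (cmap c @` (cdom c `&` cdom c')) (cmap c' \o cinv c)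
}.

Arguments mchart {R n}.
Arguments cdom {R n m}.
Arguments cmap {R n m}.
Arguments cinv {R n m}.
Arguments chart_at {R n m}.

Section Calculus.
Context {R : realType} {n : nat}.
Implicit Type M : manifold R n.

Definition cimg M (c : mchart M) : set 'rV[R]_n := cmap c @` cdom c.

(* The tangent space T_p M is 'rV[R]_n: a tangent vector at p is represented by
   its coordinates in the preferred chart chart_at p.  For p in cdom c,
   to_chart c p gives the coordinates of a tangent vector at p in the chart c,
   and of_chart c p is the inverse change of coordinates. *)
Definition to_chart M (c : mchart M) (p : M) : 'rV[R]_n -> 'rV[R]_n :=
  'd (cmap c \o cinv (chart_at p)) (cmap (chart_at p) p).

Definition of_chart M (c : mchart M) (p : M) : 'rV[R]_n -> 'rV[R]_n :=
  'd (cmap (chart_at p) \o cinv c) (cmap c p).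

Definition smooth_fun M (f : M -> R) : Prop :=
  forall c : mchart M, smooth_on (cimg c) (fun x => f (cinv c x) : R^o).

Definition dfun M (f : M -> R) (p : M) (v : 'rV[R]_n) : R :=
  'D_v (fun x => f (cinv (chart_at p) x) : R^o) (cmap (chart_at p) p).

Definition vfield_in M (c : mchart M) (X : M -> 'rV[R]_n) : 'rV[R]_n -> 'rV[R]_n :=
  fun x => to_chart c (cinv c x) (X (cinv c x)).

Definition smooth_vfield M (X : M -> 'rV[R]_n) : Prop :=
  forall c : mchart M, smooth_on (cimg c) (vfield_in c X).

Definition lie_bracket M (X Y : M -> 'rV[R]_n) (p : M) : 'rV[R]_n :=
  let c := chart_at p in
  'D_(X p) (vfield_in c Y) (cmap c p) - 'D_(Y p) (vfield_in c X) (cmap c p).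

(* oneform_in c w v is the function x |-> w(v) in the coordinates of c, where v
   is seen as a constant vector field in these coordinates. *)
Definition oneform_in M (c : mchart M) (w : M -> 'rV[R]_n -> R) (v : 'rV[R]_n) :
    'rV[R]_n -> R^o :=
  fun x => w (cinv c x) (of_chart c (cinv c x) v).

Definition is_oneform M (w : M -> 'rV[R]_n -> R) : Prop :=
  (forall (p : M) (k : R) (u v : 'rV[R]_n), w p (k *: u + v) = k * w p u + w p v) /\
  (forall (c : mchart M) (v : 'rV[R]_n), smooth_on (cimg c) (oneform_in c w v)).

(* Normalisation: dw(X,Y) = X(w(Y)) - Y(w(X)) - w([X,Y]), to be used with
   (a /\ b)(X,Y) = a(X)b(Y) - a(Y)b(X). *)
Definition ext_d M (w : M -> 'rV[R]_n -> R) (p : M) (u v : 'rV[R]_n) : R :=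
  let c := chart_at p in
  'D_u (oneform_in c w v) (cmap c p) - 'D_v (oneform_in c w u) (cmap c p).

Definition wedge M (a b : M -> 'rV[R]_n -> R) (p : M) (u v : 'rV[R]_n) : R :=
  a p u * b p v - a p v * b p u.

Definition is_metric M (g : M -> 'rV[R]_n -> 'rV[R]_n -> R) : Prop :=
  [/\ forall (p : M) (k : R) (u v w : 'rV[R]_n),
        g p (k *: u + v) w = k * g p u w + g p v w,
      forall (p : M) (u v : 'rV[R]_n), g p u v = g p v u,
      forall (p : M) (u : 'rV[R]_n), u != 0 -> 0 < g p u u &
      forall (c : mchart M) (u v : 'rV[R]_n), smooth_on (cimg c)
        (fun x => g (cinv c x) (of_chart c (cinv c x) u)
                               (of_chart c (cinv c x) v) : R^o)].

(* nabla X Y stands for the covariant derivative of Y along X; only its values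
   on smooth vector fields matter. *)
Definition is_connection M
    (nabla : (M -> 'rV[R]_n) -> (M -> 'rV[R]_n) -> (M -> 'rV[R]_n)) : Prop :=
  [/\ forall X Y, smooth_vfield X -> smooth_vfield Y -> smooth_vfield (nabla X Y),
      forall (f : M -> R) X X' Y, smooth_fun f ->
        smooth_vfield X -> smooth_vfield X' -> smooth_vfield Y ->
        forall p, nabla (fun q => f q *: X q + X' q) Y p
                  = f p *: nabla X Y p + nabla X' Y p,
      forall X Y Y', smooth_vfield X -> smooth_vfield Y -> smooth_vfield Y' ->
        forall p, nabla X (fun q => Y q + Y' q) p = nabla X Y p + nabla X Y' p &
      forall (f : M -> R) X Y, smooth_fun f -> smooth_vfield X -> smooth_vfield Y ->
        forall p, nabla X (fun q => f q *: Y q) p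
                  = dfun f p (X p) *: Y p + f p *: nabla X Y p].

Definition is_levi_civita M (g : M -> 'rV[R]_n -> 'rV[R]_n -> R)
    (nabla : (M -> 'rV[R]_n) -> (M -> 'rV[R]_n) -> (M -> 'rV[R]_n)) : Prop :=
  [/\ is_connection nabla,
      forall X Y, smooth_vfield X -> smooth_vfield Y ->
        forall p, nabla X Y p - nabla Y X p = lie_bracket X Y p &
      forall X Y Z, smooth_vfield X -> smooth_vfield Y -> smooth_vfield Z ->
        forall p, dfun (fun q => g q (Y q) (Z q)) p (X p)
                  = g p (nabla X Y p) (Z p) + g p (Y p) (nabla X Z p)].

End Calculus.

Section Maps.
Context {R : realType} {m n : nat}.
Implicit Types (M : manifold R m) (N : manifold R n).

Definition smooth_map M N (f : M -> N) : Prop :=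
  continuous f /\
  forall (c : mchart M) (c' : mchart N),
    smooth_on (cmap c @` (cdom c `&` f @^-1` cdom c')) (cmap c' \o f \o cinv c).

Definition mdiff M N (f : M -> N) (p : M) : 'rV[R]_m -> 'rV[R]_n :=
  'd (cmap (chart_at (f p)) \o f \o cinv (chart_at p)) (cmap (chart_at p) p).

(* iota presents M as an (immersed, not necessarily embedded) submanifold of N. *)
Definition is_submanifold M N (iota : M -> N) : Prop :=
  [/\ smooth_map iota, injective iota & forall p, injective (mdiff iota p)].

Definition pullback M N (f : M -> N) (w : N -> 'rV[R]_n -> R) :
    M -> 'rV[R]_m -> R :=
  fun p v => w (f p) (mdiff f p v).

End Maps.

(* Smoothness of the multiplication is read in product charts of G x G. *)
Record lie_group (R : realType) (n : nat) := LieGroup {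
  lg_mfd :> manifold R n;
  lg_mul : lg_mfd -> lg_mfd -> lg_mfd;
  lg_inv : lg_mfd -> lg_mfd;
  lg_one : lg_mfd;
  lg_mulA : associative lg_mul;
  lg_mul1 : left_id lg_one lg_mul;
  lg_mulV : left_inverse lg_one lg_inv lg_mul;
  lg_mul_continuous : continuous (fun x : lg_mfd * lg_mfd => lg_mul x.1 x.2);
  lg_mul_smooth : forall c1 c2 c3 : mchart lg_mfd,
    smooth_on
      [set z : 'rV[R]_(n + n) | [/\ cimg c1 (lsubmx z), cimg c2 (rsubmx z) &
         cdom c3 (lg_mul (cinv c1 (lsubmx z)) (cinv c2 (rsubmx z)))]]
      (fun z => cmap c3 (lg_mul (cinv c1 (lsubmx z)) (cinv c2 (rsubmx z))));
  lg_inv_smooth : smooth_map lg_inv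
}.

Section LieGroups.
Context {R : realType} {n : nat}.

Definition left_invariant (G : lie_group R n) (w : G -> 'rV[R]_n -> R) : Prop :=
  is_oneform w /\
  forall (a x : G) (v : 'rV[R]_n), pullback (lg_mul a) w x v = w x v.

End LieGroups.

Notation i1 := (@Ordinal 5 0 isT) (only parsing).
Notation i2 := (@Ordinal 5 1 isT) (only parsing).
Notation i3 := (@Ordinal 5 2 isT) (only parsing).
Notation i4 := (@Ordinal 5 3 isT) (only parsing).
Notation i5 := (@Ordinal 5 4 isT) (only parsing).

Section GroupG.
Context {R : realType}.

Definition is_left_invariant_basis (G : lie_group R 6)
    (e : 'I_5 -> G -> 'rV[R]_6 -> R) (A2 : G -> 'rV[R]_6 -> R) : Prop :=
  [/\ forall i, left_invariant (e i), left_invariant A2 &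
      forall w : G -> 'rV[R]_6 -> R, left_invariant w ->
        exists! c : 'rV[R]_5 * R, forall (x : G) (v : 'rV[R]_6),
          w x v = \sum_(i < 5) c.1 ord0 i * e i x v + c.2 * A2 x v].

Definition alpha_const (a1 a2 a3 a4 : R) : R :=
  - 2 * ((a1 - a3) * (2 * a1 + a3) + (a2 - a4) * (2 * a2 + a4)).

Definition structure_equations (a1 a2 a3 a4 : R) (G : lie_group R 6)
    (e : 'I_5 -> G -> 'rV[R]_6 -> R) (A2 : G -> 'rV[R]_6 -> R) : Prop :=
  let e1 := e i1 in let e2 := e i2 in let e3 := e i3 in
  let e4 := e i4 in let e5 := e i5 in
  forall (x : G) (u v : 'rV[R]_6),
  [/\ ext_d e1 x u v = wedge A2 e2 x u v - (2 * a1 + a3) * wedge e3 e5 x u v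
                       - (2 * a2 + a4) * wedge e4 e5 x u v,
      ext_d e2 x u v = - wedge A2 e1 x u v + (2 * a1 + a3) * wedge e4 e5 x u v
                       - (2 * a2 + a4) * wedge e3 e5 x u v,
      ext_d e3 x u v = - wedge A2 e4 x u v + (2 * a1 + a3) * wedge e1 e5 x u v
                       + (2 * a2 + a4) * wedge e2 e5 x u v &
  [/\ ext_d e4 x u v = wedge A2 e3 x u v - (2 * a1 + a3) * wedge e2 e5 x u v
                       + (2 * a2 + a4) * wedge e1 e5 x u v,
      ext_d e5 x u v =
        - 2 * (a1 - a3) * (wedge e1 e3 x u v - wedge e2 e4 x u v)
        - 2 * (a2 - a4) * (wedge e1 e4 x u v + wedge e2 e3 x u v) &
      ext_d A2 x u v =
        alpha_const a1 a2 a3 a4 * (wedge e1 e2 x u v - wedge e3 e4 x u v)]].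

End GroupG.

Section AlmostContact.
Context {R : realType} {M : manifold R 5}.

Definition is_almost_contact_metric (g : M -> 'rV[R]_5 -> 'rV[R]_5 -> R)
    (xi : M -> 'rV[R]_5) (eta : M -> 'rV[R]_5 -> R)
    (phi : M -> 'rV[R]_5 -> 'rV[R]_5) : Prop :=
  [/\ is_metric g,
      smooth_vfield xi /\ (forall p, g p (xi p) (xi p) = 1),
      forall p v, eta p v = g p (xi p) v,
      (forall p (k : R) u v, phi p (k *: u + v) = k *: phi p u + phi p v) /\
      (forall (c : mchart M) v, smooth_on (cimg c)
         (fun x => to_chart c (cinv c x)
                     (phi (cinv c x) (of_chart c (cinv c x) v)))) &
  [/\ forall p, phi p (xi p) = 0,
      forall p v, phi p (phi p v) = - v + eta p v *: xi p &
      forall p u v, g p (phi p u) (phi p v) = g p u v - eta p u * eta p v]].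

(* Frames are identified with coframes through g.  No orientation is fixed
   beforehand on M: it is the one for which E is oriented. *)
Definition is_adapted_frame (g : M -> 'rV[R]_5 -> 'rV[R]_5 -> R)
    (eta : M -> 'rV[R]_5 -> R) (phi : M -> 'rV[R]_5 -> 'rV[R]_5)
    (E : 'I_5 -> M -> 'rV[R]_5) : Prop :=
  let e i : M -> 'rV[R]_5 -> R := fun p v => g p (E i p) v in
  [/\ forall i, smooth_vfield (E i),
      forall p i j, g p (E i p) (E j p) = (i == j)%:R,
      forall p u v, g p u (phi p v) =
        wedge (e i1) (e i2) p u v + wedge (e i3) (e i4) p u v &
      forall p v, eta p v = e i5 p v].

End AlmostContact.

(* Components with respect to an adapted frame: a 2-form beta is the skew matrix
   beta i j = beta(e_i,e_j), which also realises so(5) = Lambda^2. *)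
Section Algebra.
Context {R : realType}.
Implicit Types (beta gamma : 'M[R]_5) (T : 'I_5 -> 'I_5 -> 'I_5 -> R).

Definition skew beta : Prop := beta^T = - beta.

Definition eta5 (i : 'I_5) : R := (i == i5)%:R.

Definition e2form (a b : 'I_5) : 'M[R]_5 := delta_mx a b - delta_mx b a.

Definition Phi5 : 'M[R]_5 := e2form i1 i2 + e2form i3 i4.

Definition levi_civita_symbol (t : 5.-tuple 'I_5) : R :=
  \prod_(b < 5) \prod_(a < 5 | (a < b)%N)
    Num.sg ((tnth t b : nat)%:R - (tnth t a : nat)%:R).

(* Hodge operator from 2-forms to 3-forms: e_I /\ *e_I = e_1 /\ ... /\ e_5. *)
Definition hodge2 beta (i j k : 'I_5) : R :=
  2^-1 * \sum_(l < 5) \sum_(m < 5)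
    beta l m * levi_civita_symbol [tuple l; m; i; j; k].

Definition wedge_eta beta (i j k : 'I_5) : R :=
  eta5 i * beta j k + eta5 j * beta k i + eta5 k * beta i j.

Definition wedge22 beta gamma (i j k l : 'I_5) : R :=
  beta i j * gamma k l - beta i k * gamma j l + beta i l * gamma j k
  + beta j k * gamma i l - beta j l * gamma i k + beta k l * gamma i j.

Definition Lambda2_1 beta : Prop := exists t : R, beta = t *: Phi5.

Definition Lambda2_2 beta : Prop :=
  [/\ skew beta, forall i j k l, wedge22 Phi5 beta i j k l = 0 &
      forall i j k, hodge2 beta i j k = wedge_eta beta i j k].

Definition Lambda2_3 beta : Prop :=
  skew beta /\ forall i j k, hodge2 beta i j k = - wedge_eta beta i j k.

Definition Lambda2_4 beta : Prop :=
  skew beta /\ forall i j k, wedge_eta beta i j k = 0.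

Definition u2 beta : Prop :=
  exists b1 b3, [/\ Lambda2_1 b1, Lambda2_3 b3 & beta = b1 + b3].

Definition u2_perp beta : Prop :=
  exists b2 b4, [/\ Lambda2_2 b2, Lambda2_4 b4 & beta = b2 + b4].

(* Projection along the decomposition Lambda^2 = u(2) (+) u(2)^perp. *)
Definition pr_u2_perp beta : 'M[R]_5 :=
  get [set gamma | u2_perp gamma /\ u2 (beta - gamma)].

Definition theta beta : 'I_5 -> 'I_5 -> 'I_5 -> R := hodge2 beta.

Definition vartheta beta : 'I_5 -> 'I_5 -> 'I_5 -> R :=
  fun i j k => 3 * eta5 i * beta j k - hodge2 beta i j k.

Definition W4 T : Prop :=
  exists beta, Lambda2_2 beta /\ forall i j k, T i j k = theta beta i j k.

Definition W7 T : Prop :=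
  exists beta, Lambda2_2 beta /\ forall i j k, T i j k = vartheta beta i j k.

Definition W4_plus_W7 T : Prop :=
  exists T4 T7, [/\ W4 T4, W7 T7 & forall i j k, T i j k = T4 i j k + T7 i j k].

End Algebra.

Section Torsion.
Context {R : realType} {M : manifold R 5}.

(* The matrix Omega^g(E_i), with entries omega_jk(E_i) = g(nabla_{E_i} E_j, E_k). *)
Definition connection_matrix (g : M -> 'rV[R]_5 -> 'rV[R]_5 -> R)
    (nabla : (M -> 'rV[R]_5) -> (M -> 'rV[R]_5) -> (M -> 'rV[R]_5))
    (E : 'I_5 -> M -> 'rV[R]_5) (p : M) (i : 'I_5) : 'M[R]_5 :=
  \matrix_(j, k) g p (nabla (E i) (E j) p) (E k p).

Definition intrinsic_torsion (g : M -> 'rV[R]_5 -> 'rV[R]_5 -> R)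
    (nabla : (M -> 'rV[R]_5) -> (M -> 'rV[R]_5) -> (M -> 'rV[R]_5))
    (E : 'I_5 -> M -> 'rV[R]_5) (p : M) (i j k : 'I_5) : R :=
  pr_u2_perp (connection_matrix g nabla E p i) j k.

(* The torsion is computed in the adapted frame E; the classes are invariant
   under U(2), so that the choice of E is immaterial. *)
Definition of_class (W : ('I_5 -> 'I_5 -> 'I_5 -> R) -> Prop)
    (g : M -> 'rV[R]_5 -> 'rV[R]_5 -> R)
    (nabla : (M -> 'rV[R]_5) -> (M -> 'rV[R]_5) -> (M -> 'rV[R]_5))
    (E : 'I_5 -> M -> 'rV[R]_5) : Prop :=
  forall p : M, W (intrinsic_torsion g nabla E p).

End Torsion.

(* Main.v *)
Require Import Defs.
From mathcomp Require Import ring lra.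
Set Implicit Arguments.
Unset Strict Implicit.
Unset Printing Implicit Defensive.
Import Order.TTheory GRing.Theory Num.Theory.
Local Open Scope classical_set_scope.
Local Open Scope ring_scope.

(* The coframe of M is the pullback of left invariant forms, so by naturality of
   the exterior derivative the structure equations give the brackets of the frame
   E: e_k([E_i, E_j]) = - de_k(E_i, E_j) is constant up to terms in the unknown
   function A2(E_i).  The Koszul formula then gives g(nabla_{E_i} E_j, E_k), and
   the A2-terms lie in u(2), so the projection to u(2)^perp kills them.  What is
   left is theta(b) + vartheta(b') with b = a1 (e13 - e24) + a2 (e14 + e23) and
   b' = a3 (e13 - e24) + a4 (e14 + e23).  The (1,3,5), (5,1,3), (1,4,5) and
   (5,1,4) components separate the two summands.
   Naturality of d is the chain rule in charts together with the symmetry of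
   second derivatives of the local expression of the map. *)

(** * Second derivatives *)

Section DirectionalDerivatives.
Context {R : realType}.
Implicit Types V W : normedModType R.

Lemma is_derive_line V W (f : V -> W) (x u : V) (s : R) :
  differentiable f (s *: u + x) ->
  is_derive s 1 (fun t : R => f (t *: u + x)) ('D_u f (s *: u + x)).
Proof.
move=> df.
pose l (t : R) := t *: u + x.
have line : is_diff s l ( *:%R^~ u).
  by apply: is_diff_eq; rewrite addr0.
have dl : differentiable f (l s) by [].
have dfl : differentiable (f \o l) s by exact: differentiable_comp.
rewrite -[X in is_derive _ _ X _]/(f \o l).
apply: DeriveDef; first exact: diff_derivable.
by rewrite deriveE// deriveE// diff_comp//= diff_val scale1r.
Qed.

(* Mean value theorem for [s |-> f (s u + h v + x) - f (s u + x)] on [0, h]. *)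
Lemma second_difference_estimate V (f D : V -> R^o) (x u v : V) (e : R) :
  0 < e -> (\forall y \near x, differentiable f y /\ 'D_u f y = D y) ->
  differentiable D x ->
  \forall h \near 0^'+,
    `|f (h *: u + (h *: v + x)) - f (h *: u + x) - (f (h *: v + x) - f x)
      - h ^+ 2 * 'D_v D x| <= e * h ^+ 2.
Proof.
move=> e0 df dD.
(* The mean value point will leave increments [c u + h v] and [c u] with [c <= h], whose norms add
   up to at most [h (2|u| + |v|)]. The extra 1 keeps [N] positive when [u] and [v] vanish. *)
pose N := 2 * `|u| + `|v| + 1.
have N0 : 0 < N by rewrite ltr_wpDl// addr_ge0// mulr_ge0.
pose e' := e / N.
have e'0 : 0 < e' by rewrite divr_gt0.
have /nbhs_normP[d d0 Hd] : \forall y \near (0 : V),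
    (differentiable f (y + x) /\ 'D_u f (y + x) = D (y + x)) /\
    `|D (y + x) - (D x + 'd D x y)| <= e' * `|y|.
  apply: filterI.
    by move: df; rewrite (near_shift 0) subr0.
  by have /eqaddoP/(_ _ e'0) := diff_locally dD.
have {}Hd y : `|y| < d ->
    (differentiable f (y + x) /\ 'D_u f (y + x) = D (y + x)) /\
    `|D (y + x) - (D x + 'd D x y)| <= e' * `|y|.
  by move=> yd; apply: Hd; rewrite /= sub0r normrN.
near=> h.
have h0 : 0 < h by [].
have hd : h * (`|u| + `|v| + 1) < d.
  have n0 : 0 < `|u| + `|v| + 1 by rewrite ltr_wpDl// addr_ge0.
  by rewrite -ltr_pdivlMr//; near: h; apply: nbhs_right_lt; rewrite divr_gt0.
have small (s : R) : 0 <= s <= h ->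
    `|s *: u| <= h * `|u| /\ `|s *: u + h *: v| <= h * `|u| + h * `|v|.
  move=> /andP[s0 sh]; have su : `|s *: u| <= h * `|u|.
    by rewrite normrZ ger0_norm// ler_wpM2r.
  split=> //; apply: (le_trans (ler_normD _ _)); apply: lerD => //.
  by rewrite normrZ gtr0_norm.
have lt_d (s : R) : 0 <= s <= h -> `|s *: u| < d /\ `|s *: u + h *: v| < d.
  move=> /small[s1 s2]; have hv : 0 <= h * `|v| by rewrite mulr_ge0// ltW.
  by split; lra.
pose phi (s : R) : R := f (s *: u + (h *: v + x)) - f (s *: u + x).
pose dphi (s : R) : R := D (s *: u + (h *: v + x)) - D (s *: u + x).
have phi' s : 0 <= s <= h -> is_derive s 1 phi (dphi s).
  move=> /lt_d[/Hd[[d1 D1] _] /Hd[[+ +] _]]; rewrite -addrA => d2 D2.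
  by rewrite /dphi -D1 -D2; apply: is_deriveB; apply: is_derive_line.
have [||c] := @MVT R phi dphi 0 h h0.
- by move=> s; rewrite in_itv/= => /andP[/ltW s0 /ltW s1]; apply: phi'; rewrite s0.
- apply: derivable_within_continuous => s; rewrite in_itv/= => hs.
  by have [] := phi' _ hs.
rewrite in_itv/= => /andP[/ltW c0 /ltW ch].
have ch' : 0 <= c <= h by rewrite c0.
rewrite /phi /dphi !scale0r !add0r subr0 => ->.
have [c1 c2] := lt_d _ ch'; have [c3 c4] := small _ ch'.
have [_ Q] := Hd _ c1; have [_ P] := Hd _ c2.
rewrite deriveE// [c *: u + (h *: v + x)]addrA.
have dDl : 'd D x (c *: u + h *: v) = 'd D x (c *: u) + h * 'd D x v.
  by rewrite linearD; congr (_ + _); rewrite linearZ.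
move: P; rewrite dDl.
set D1 := D (_ + x) in Q *; set D2 := D (_ + x); set L := 'd D x v.
set Lc := 'd D x (c *: u) in Q *.
(* Both values of [D] are compared with the linearisation of [D] at [x]; the common part [D x + Lc]
   cancels, and only the two error terms remain. *)
move=> P; have -> : (D2 - D1) * h - h ^+ 2 * L
   = h * ((D2 - (D x + (Lc + h * L))) - (D1 - (D x + Lc))) by ring.
rewrite normrM gtr0_norm// expr2 [e * _]mulrCA ler_pM2l//.
apply: (le_trans (ler_normB _ _)).
have PQ : e' * `|c *: u + h *: v| + e' * `|c *: u| <= e * h.
  rewrite -mulrDr (_ : e = e' * N) ?mulrA; last by rewrite divfK// gt_eqF.
  rewrite -mulrA ler_pM2l//.
  rewrite /N; lra.
by apply: le_trans PQ; apply: lerD.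
Unshelve. all: by end_near.
Qed.

(** If two numbers both lie within a quarter of their distance from [z / k], that distance is at
    most half of itself, hence zero. *)
Lemma eq_of_close (y1 y2 z k : R) : 0 < k ->
  `|z - k * y1| <= `|y1 - y2| / 4 * k -> `|z - k * y2| <= `|y1 - y2| / 4 * k ->
  y1 = y2.
Proof.
move=> k0 z1 z2; apply/subr0_eq/normr0_eq0/le_anti; rewrite normr_ge0 andbT.
have : `|(y1 - y2) * k| <= `|y1 - y2| / 4 * k + `|y1 - y2| / 4 * k.
  have -> : (y1 - y2) * k = (z - k * y2) - (z - k * y1) by ring.
  by apply: (le_trans (ler_normB _ _)); exact: lerD.
rewrite normrM (gtr0_norm k0) -mulrDl ler_pM2r//; set t := `|_|; clearbody t.
lra.
Qed.

(** The second difference of [f] along [h u] and [h v] is symmetric in [u] and [v], and divided by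
    [h ^+ 2] it approximates either mixed derivative. [Du] and [Dv] need only agree with the
    derivatives near [x], so that coordinates of vector-valued derivatives can be put in their
    place. *)
Lemma schwarz V (f Du Dv : V -> R^o) (x u v : V) :
  (\forall y \near x, differentiable f y) ->
  {near x, 'D_u f =1 Du} -> {near x, 'D_v f =1 Dv} ->
  differentiable Du x -> differentiable Dv x ->
  'D_u Dv x = 'D_v Du x.
Proof.
move=> df fu fv du dv; apply: contrapT => /eqP ne.
have e4 : 0 < `|'D_u Dv x - 'D_v Du x| / 4.
  by rewrite divr_gt0// normr_gt0 subr_eq0.
have Hu : \forall y \near x, differentiable f y /\ 'D_u f y = Du y by exact: filterI.
have Hv : \forall y \near x, differentiable f y /\ 'D_v f y = Dv y by exact: filterI.
have H1 := second_difference_estimate u e4 Hv dv.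
have H2 := second_difference_estimate v e4 Hu du.
have [h [h0 [A B]]] := filter_ex (filterI (nbhs_right_gt (0 : R)) (filterI H1 H2)).
move/eqP: ne; apply; apply: (eq_of_close _ A); first exact: exprn_gt0.
(* Exchanging the two middle terms turns the second difference for [(v, u)] into the one for
   [(u, v)]. *)
have swap (a b c d : R) : a - b - (c - d) = a - c - (b - d) by ring.
by rewrite [h *: v + (h *: u + x)]addrCA swap.
Qed.

Lemma schwarz_rV V n (F : V -> 'rV[R]_n) (x u v : V) :
  (\forall y \near x, differentiable F y) ->
  differentiable ('D_u F) x -> differentiable ('D_v F) x ->
  'D_u ('D_v F) x = 'D_v ('D_u F) x.
Proof.
move=> dF du dv.
have coordD i (H : V -> 'rV[R]_n) y : differentiable H y ->
    differentiable (fun y => H y 0 i : R^o) y.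
  move=> dH; apply: (@differentiable_comp _ _ _ _ H
    (fun N : 'rV[R]_n => N 0 i : R^o)) => //; exact: differentiable_coord.
have coordE w i : {near x, 'D_w (fun y => F y 0 i : R^o) =1
    (fun y => 'D_w F y 0 i : R^o)}.
  by apply: filterS dF => y dy; rewrite derive_mx ?mxE//; exact: diff_derivable.
have comp w w' i : differentiable ('D_w' F) x ->
    'D_w ('D_w' F) x 0 i = 'D_w (fun y => 'D_w' F y 0 i : R^o) x.
  by move=> d; rewrite derive_mx ?mxE//; exact: diff_derivable.
apply/rowP => i; apply: (etrans (comp u v i dv)); apply: esym.
apply: (etrans (comp v u i du)); apply: esym.
apply: (@schwarz V (fun y => F y 0 i)) (coordE u i) (coordE v i) _ _.
- by apply: filterS dF => y; exact: coordD.
- exact: coordD du.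
- exact: coordD dv.
Qed.

Lemma is_derive_scale V W (k : V -> R^o) (f : V -> W) (x v : V) dk df :
  is_derive x v k dk -> is_derive x v f df ->
  is_derive x v (fun y => k y *: f y) (dk *: f x + k x *: df).
Proof.
move=> [kx <-] [fx <-].
have lim : (fun h => h^-1 *: (((fun y => k y *: f y) \o shift x) (h *: v)
    - k x *: f x)) @ 0^' --> 'D_v k x *: f x + k x *: 'D_v f x.
  rewrite addrC; evar (kf : R -> W); rewrite [X in X @ _](_ : _ = kf) /=; last first.
    rewrite funeqE => h.
    have -> : k (h *: v + x) *: f (h *: v + x) - k x *: f x =
      k (h *: v + x) *: (f (h *: v + x) - f x) + (k (h *: v + x) - k x) *: f x.
      by rewrite scalerBr scalerBl addrA subrK.
    rewrite scalerDr scalerA mulrC -scalerA [_ *: (_ *: f x)]scalerA /kf.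
    reflexivity.
  apply: cvgD; last exact: cvgZr_tmp kx.
  apply: cvgZ; last exact: fx.
  (* Derivability of [k] in the single direction [v] gives continuity only along this line, which is
     all that the limit requires. *)
  suff : {for 0, continuous (fun h : R => k (h *: v + x))}.
    by move=> /continuous_withinNx; rewrite scale0r add0r.
  exact/differentiable_continuous/derivable1_diffP/(derivable1P _ _ _).1.
by apply: DeriveDef; [apply/cvg_ex; eexists; exact: lim | apply: cvg_lim lim].
Qed.

(** A product rule: expanding [G] in the standard basis turns [Om y (G y)] into a finite sum of
    scalar functions times vector-valued ones. It serves both for differentials ['d F x] and for
    one-forms in a chart. *)
Lemma is_derive_linear_family V W n (Om : V -> 'rV[R]_n -> W) (G : V -> 'rV[R]_n)
    (x u : V) :
  (forall y k a b, Om y (k *: a + b) = k *: Om y a + Om y b) ->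
  (forall a, derivable (Om^~ a) x u) -> derivable G x u ->
  is_derive x u (fun y => Om y (G y)) ('D_u (Om^~ (G x)) x + Om x ('D_u G x)).
Proof.
move=> lin dOm dG.
have Om0 y : Om y 0 = 0.
  by have := lin y (-1) 0 0; rewrite scaler0 addr0 scaleN1r addNr.
have sumE y a : Om y a = \sum_(i < n) a 0 i *: Om y (delta_mx 0 i).
  rewrite {1}[a]row_sum_delta; elim/big_rec2 : _ => // i b c _ <-.
  by rewrite lin.
have dGi i : is_derive x u (fun y => G y 0 i : R^o) ('D_u G x 0 i).
  rewrite derive_mx// mxE; apply: DeriveDef => //.
  exact: (derivable_mxP _ _ _).1.
have -> : (fun y => Om y (G y)) =
    \sum_(i < n) (fun y => G y 0 i *: Om y (delta_mx 0 i)).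
  by apply/funext => y; rewrite sumE fct_sumE.
have -> : 'D_u (Om^~ (G x)) x =
    \sum_(i < n) G x 0 i *: 'D_u (Om^~ (delta_mx 0 i)) x.
  have -> : Om^~ (G x) = \sum_(i < n) (G x 0 i *: Om^~ (delta_mx 0 i)).
    by apply/funext => y; rewrite sumE fct_sumE.
  rewrite derive_sum; last by move=> i; apply: derivableZ.
  by apply: eq_bigr => i _; rewrite deriveZ.
rewrite sumE addrC -big_split/=; apply: is_derive_sum => i.
by apply: is_derive_scale => //; apply: DeriveDef.
Qed.

End DirectionalDerivatives.

(** * Naturality of the exterior derivative *)

Lemma smooth_on_differentiable (R : realType) (V W : normedModType R)
    (U : set V) (f : V -> W) (x : V) :
  smooth_on U f -> U x -> differentiable f x.
Proof. by move=> /(_ [::]); apply. Qed.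

Lemma smooth_on_derive (R : realType) (V W : normedModType R)
    (U : set V) (f : V -> W) (v : V) :
  smooth_on U f -> smooth_on U ('D_v f).
Proof.
move=> Uf s x /(Uf (rcons s v)).
(* The last direction in the list of [iter_derive] is the one differentiated first. *)
suff -> : iter_derive (rcons s v) f = iter_derive s ('D_v f) by [].
by elim: s => //= w s ->.
Qed.

(* [k] need not be equal to [g \o f] away from [x], as happens for transition maps,
   which have irrelevant values off the chart domains. *)
Lemma diff_near_comp (R : realType) (U V W : normedModType R)
    (f : U -> V) (g : V -> W) (k : U -> W) (x v : U) (y : V) :
  f x = y -> differentiable f x -> differentiable g y -> differentiable k x ->
  {near x, k =1 g \o f} -> 'd k x v = 'd g y ('d f x v).
Proof.
move=> <- df dg dk kE; rewrite -deriveE// (near_eq_derive _ kE) deriveE.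
  by rewrite diff_comp.
exact: differentiable_comp.
Qed.

(** * Charts and changes of coordinates *)

Section Charts.
Context {R : realType} {n : nat} {M : manifold R n}.
Implicit Types (c d : mchart M) (p : M).

Lemma cimg_cmap c p : cdom c p -> cimg c (cmap c p).
Proof. by move=> cp; exists p. Qed.

Lemma cinv_cdom c x : cimg c x -> cdom c (cinv c x).
Proof. by move=> [p cp <-]; rewrite cmapK. Qed.

Lemma cinvK c x : cimg c x -> cmap c (cinv c x) = x.
Proof. by move=> [p cp <-]; rewrite cmapK. Qed.

Lemma cimg_nbhs c x : cimg c x -> \forall y \near x, cimg c y.
Proof. by move=> cx; apply: open_nbhs_nbhs; split=> //; exact: cimg_open. Qed.

Lemma cdom_nbhs c p : cdom c p -> \forall q \near p, cdom c q.
Proof. by move=> cp; apply: open_nbhs_nbhs; split=> //; exact: cdom_open. Qed.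

Lemma cinv_cvg c x : cimg c x -> {for x, continuous (cinv c)}.
Proof.
have := @cinv_continuous _ _ M c.
rewrite continuous_open_subspace; last exact: cimg_open.
by move=> h cx; apply: h; rewrite inE.
Qed.

Lemma near_cinv c p (P : set M) : cdom c p -> (\forall q \near p, P q) ->
  \forall x \near cmap c p, P (cinv c x).
Proof.
by move=> cp Pp; apply: (cinv_cvg (cimg_cmap cp)); rewrite cmapK.
Qed.

Lemma transition_differentiable c d p : cdom c p -> cdom d p ->
  differentiable (cmap d \o cinv c) (cmap c p).
Proof.
move=> cp dp; apply: (smooth_on_differentiable (@transition_smooth _ _ M c d)).
by exists p.
Qed.

Lemma to_chart_at p v : to_chart (chart_at p) p v = v.
Proof.
have cp := chart_at_dom p; rewrite /to_chart -deriveE; last first.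
  exact: transition_differentiable.
rewrite (near_eq_derive (g := id)) ?derive_id//.
by apply: filterS (cimg_nbhs (cimg_cmap cp)) => x /cinvK.
Qed.

Lemma of_chartP c p k u v :
  of_chart c p (k *: u + v) = k *: of_chart c p u + of_chart c p v.
Proof. exact: linearP. Qed.

End Charts.

(** * Smooth maps in charts and pullbacks of one-forms *)

Section SmoothMaps.
Context {R : realType} {m n : nat} {M : manifold R m} {N : manifold R n}.
Variable f : M -> N.
Hypothesis fS : smooth_map f.
Implicit Types (c : mchart M) (d : mchart N) (p : M).

Lemma near_map p (P : set N) : (\forall q \near f p, P q) ->
  \forall q \near p, P (f q).
Proof. exact: fS.1. Qed.

Lemma smooth_map_differentiable c d p : cdom c p -> cdom d (f p) ->
  differentiable (cmap d \o f \o cinv c) (cmap c p).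
Proof.
by move=> cp dp; apply: (smooth_on_differentiable (fS.2 c d)); exists p.
Qed.

(** Near [p] the expression of [f] in the preferred charts is its expression in [c] and [d] composed
    with a transition map on either side. The chain rule is applied once for each side. *)
Lemma mdiffE c d p v : cdom c p -> cdom d (f p) ->
  mdiff f p v =
  of_chart d (f p) ('d (cmap d \o f \o cinv c) (cmap c p) (to_chart c p v)).
Proof.
move=> cp dp; set e := chart_at p; set e' := chart_at (f p).
have ep : cdom e p := chart_at_dom p.
have e'p : cdom e' (f p) := chart_at_dom (f p).
pose F := cmap d \o f \o cinv c; pose t := cmap c \o cinv e.
have tE : t (cmap e p) = cmap c p by rewrite /t /= cmapK.
have FE : F (cmap c p) = cmap d (f p) by rewrite /F /= cmapK.
have dt : differentiable t (cmap e p) by exact: transition_differentiable.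
have dF : differentiable F (t (cmap e p)).
  by rewrite tE; exact: smooth_map_differentiable.
have FtE : (F \o t) (cmap e p) = cmap d (f p) by rewrite /= tE.
have dFt : differentiable (F \o t) (cmap e p) by exact: differentiable_comp.
have -> : 'd F (cmap c p) (to_chart c p v) = 'd (F \o t) (cmap e p) v.
  by apply/esym/(diff_near_comp _ tE dt _ dFt); [rewrite -tE | exact: filterE].
apply: (diff_near_comp _ FtE dFt).
- exact: transition_differentiable.
- exact: smooth_map_differentiable.
- have : \forall y \near cmap e p, cdom c (cinv e y) /\ cdom d (f (cinv e y)).
    apply: filterI; first exact: (near_cinv ep (cdom_nbhs cp)).
    exact: (near_cinv ep (near_map (cdom_nbhs dp))).
  by apply: filterS => y [cy dy]; rewrite /F /t /= !cmapK.
Qed.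

Lemma smooth_map_derive_differentiable c d p v : cdom c p -> cdom d (f p) ->
  differentiable ('D_v (cmap d \o f \o cinv c)) (cmap c p).
Proof.
move=> cp dp.
by apply: (smooth_on_differentiable (smooth_on_derive v (fS.2 c d))); exists p.
Qed.

Section PullbackOneForm.
Variable w : N -> 'rV[R]_n -> R.
Hypothesis wF : is_oneform w.

Lemma oneform_inP d y k a b :
  oneform_in d w (k *: a + b) y = k *: oneform_in d w a y + oneform_in d w b y.
Proof. by rewrite /oneform_in of_chartP wF.1. Qed.

Lemma oneform_in_differentiable d q v : cdom d q ->
  differentiable (oneform_in d w v) (cmap d q).
Proof.
move=> dq; apply: (smooth_on_differentiable (wF.2 d v)); exact: cimg_cmap.
Qed.

Lemma pullbackE c d p v : cdom c p -> cdom d (f p) ->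
  pullback f w p v =
  oneform_in d w ('d (cmap d \o f \o cinv c) (cmap c p) (to_chart c p v))
    (cmap d (f p)).
Proof. by move=> cp dp; rewrite /pullback /oneform_in cmapK// -mdiffE. Qed.

(** In charts the constant function [w(f_* Z)] depends on the point through the coefficients of [w],
    the differential of [F] and the field [Z]. Differentiating it along [u] gives one term for each
    of the three, and their sum is zero. *)
Lemma derive_pullback c d (Z : M -> 'rV[R]_m) (u : 'rV[R]_m) (k : R) p :
  let F := cmap d \o f \o cinv c in
  let x0 := cmap c p in
  let y0 := cmap d (f p) in
  let z := to_chart c p (Z p) in
  cdom c p -> cdom d (f p) ->
  smooth_vfield Z -> (forall q, pullback f w q (Z q) = k) ->
  'D_('d F x0 u) (oneform_in d w ('d F x0 z)) y0
  + oneform_in d w ('D_u ('D_z F) x0 + 'd F x0 ('D_u (vfield_in c Z) x0)) y0 = 0.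
Proof.
move=> F x0 y0 z cp dp ZS Zk.
have FE : F x0 = y0 by rewrite /F /x0 /= cmapK.
have zE : vfield_in c Z x0 = z by rewrite /vfield_in cmapK.
have dF : differentiable F x0 by exact: smooth_map_differentiable.
have nearF : \forall x \near x0, cimg c x /\ cdom d (f (cinv c x)).
  apply: filterI; first by apply: cimg_nbhs; exact: cimg_cmap.
  exact: (near_cinv cp (near_map (cdom_nbhs dp))).
(* Differentials near [x0] are rewritten as directional derivatives, so that differentiating
   ['d F x z] produces the second derivative of [F]. *)
have dFb b : {near x0, 'D_b F =1 (fun x => 'd F x b)}.
  apply: filterS nearF => x [cx dx]; rewrite -deriveE// -[x](cinvK cx).
  by apply: smooth_map_differentiable => //; exact: cinv_cdom.
have dZ : derivable (vfield_in c Z) x0 u.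
  apply: diff_derivable; apply: (smooth_on_differentiable (ZS c)).
  exact: cimg_cmap.
have dFZ : is_derive x0 u (fun x => 'd F x (vfield_in c Z x))
    ('D_u ('D_z F) x0 + 'd F x0 ('D_u (vfield_in c Z) x0)).
  rewrite (near_eq_derive _ (dFb z)) -zE.
  apply: (@is_derive_linear_family _ _ _ _ (fun x b => 'd F x b)) => //.
    by move=> y l a b; exact: linearP.
  move=> b; apply: (near_eq_derivable (dFb b)); apply: diff_derivable.
  exact: smooth_map_derive_differentiable.
have dW a : is_derive x0 u (fun x => oneform_in d w a (F x))
    ('D_('d F x0 u) (oneform_in d w a) y0).
  have dwa : differentiable (oneform_in d w a) (F x0).
    by rewrite FE; exact: oneform_in_differentiable.
  have dwF : differentiable (oneform_in d w a \o F) x0.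
    exact: differentiable_comp.
  apply: DeriveDef; first exact: (diff_derivable dwF).
  by rewrite -FE (deriveE _ dwF) (deriveE _ dwa) diff_comp.
have dWFZ : is_derive x0 u (fun x => oneform_in d w ('d F x (vfield_in c Z x)) (F x))
    ('D_('d F x0 u) (oneform_in d w ('d F x0 z)) y0
  + oneform_in d w ('D_u ('D_z F) x0 + 'd F x0 ('D_u (vfield_in c Z) x0)) y0).
  have := @is_derive_linear_family _ _ _ _
    (fun x a => oneform_in d w a (F x)) (fun x => 'd F x (vfield_in c Z x)) x0 u.
  rewrite zE FE (@derive_val _ _ _ _ _ _ _ (dW _)) (@derive_val _ _ _ _ _ _ _ dFZ).
  apply.
  - by move=> *; exact: oneform_inP.
  - by move=> a; have [] := dW a.
  - by have [] := dFZ.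
rewrite -(@derive_val _ _ _ _ _ _ _ dWFZ) (near_eq_derive (g := cst k)) ?derive_cst//.
apply: filterS nearF => x [cx dx].
rewrite -(Zk (cinv c x)) (pullbackE _ (cinv_cdom cx) dx) cinvK//.
Qed.

(** Subtract the instances of [derive_pullback] for [(X p, Y)] and [(Y p, X)]. The second
    derivatives of [F] cancel by symmetry; the derivatives of [w] form [ext_d w], and those of the
    fields form the bracket. *)
Lemma pullback_lie_bracket (X Y : M -> 'rV[R]_m) (kX kY : R) p :
  smooth_vfield X -> smooth_vfield Y ->
  (forall q, pullback f w q (X q) = kX) -> (forall q, pullback f w q (Y q) = kY) ->
  pullback f w p (lie_bracket X Y p) =
  - ext_d w (f p) (mdiff f p (X p)) (mdiff f p (Y p)).
Proof.
move=> XS YS Xk Yk; have cp := chart_at_dom p; have dp := chart_at_dom (f p).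
have := derive_pullback (X p) cp dp YS Yk.
have := derive_pullback (Y p) cp dp XS Xk.
rewrite (pullbackE _ cp dp) /ext_d /mdiff /lie_bracket !to_chart_at.
set c := chart_at p; set d := chart_at (f p); set F := cmap d \o f \o cinv c.
rewrite /=; set W := oneform_in d w.
have WD a b y : W (a + b) y = W a y + W b y.
  by have := oneform_inP d y 1 a b; rewrite !scale1r.
have WB a b y : W (a - b) y = W a y - W b y.
  by rewrite addrC -scaleN1r /W oneform_inP scaleN1r addrC.
have sym : 'D_(X p) ('D_(Y p) F) (cmap c p) = 'D_(Y p) ('D_(X p) F) (cmap c p).
  apply: schwarz_rV; try exact: smooth_map_derive_differentiable.
  have nearF : \forall x \near cmap c p, cimg c x /\ cdom d (f (cinv c x)).
    apply: filterI; first by apply: cimg_nbhs; exact: cimg_cmap.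
    exact: (near_cinv cp (near_map (cdom_nbhs dp))).
  apply: filterS nearF => x [cx dx]; rewrite -[x](cinvK cx).
  by apply: smooth_map_differentiable => //; exact: cinv_cdom.
rewrite (linearB ('d F (cmap c p))) WB !WD sym.
set D1 := 'D_('d _ _ _) _ _; set D2 := 'D_('d _ _ _) _ _.
set w1 := W _ _; set w2 := W _ _; set w3 := W _ _.
clearbody D1 D2 w1 w2 w3; lra.
Qed.

End PullbackOneForm.
End SmoothMaps.

(** * Two-forms in dimension five *)

Lemma ord5_ind (P : 'I_5 -> Prop) :
  P i1 -> P i2 -> P i3 -> P i4 -> P i5 -> forall i, P i.
Proof.
move=> P1 P2 P3 P4 P5 [[|[|[|[|[|//]]]]] lti];
  [move: P1 | move: P2 | move: P3 | move: P4 | move: P5];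
  by congr P; apply: val_inj.
Qed.

Lemma sum_ord5 (V : nmodType) (F : 'I_5 -> V) :
  \sum_(i < 5) F i = F i1 + F i2 + F i3 + F i4 + F i5.
Proof.
rewrite !big_ord_recr big_ord0 /= add0r.
by congr (_ + _ + _ + _ + _); congr F; apply: val_inj.
Qed.

(** Integer values at [nat] indices let the coefficients be evaluated by [vm_compute]. *)
Definition e2formZ (a b i j : nat) : int :=
  ((i == a) && (j == b))%:Z - ((i == b) && (j == a))%:Z.

Ltac eval_e2formZ := repeat match goal with |- context [e2formZ ?a ?b ?i ?j] =>
  let v := eval vm_compute in (e2formZ a b i j) in
  change (e2formZ a b i j) with v end;
  rewrite ?(mulr0z, mulr1z, mulrN1z).

Section TwoForms.
Context {R : realType}.
Implicit Types (b : 'M[R]_5) (s t : R).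

Definition sgZ (x y : nat) : int :=
  if (x < y)%N then 1 else if (y < x)%N then -1 else 0.

Lemma sgZE x y : Num.sg (y%:R - x%:R : R) = (sgZ x y)%:~R.
Proof.
rewrite /sgZ; case: ltngtP => [xy|yx|->].
- by rewrite gtr0_sg// subr_gt0 ltr_nat.
- by rewrite ltr0_sg// subr_lt0 ltr_nat.
- by rewrite subrr sgr0.
Qed.

Lemma sgZC x y : sgZ y x = - sgZ x y.
Proof. by rewrite /sgZ; case: ltngtP. Qed.

(** The signs of the ten index differences, grouped in the order in which the double product of
    [levi_civita_symbol] unfolds. *)
Definition levi_civita5 (l m i j k : nat) : int :=
  sgZ l m * (sgZ l i * sgZ m i) * (sgZ l j * sgZ m j * sgZ i j)
  * (sgZ l k * sgZ m k * sgZ i k * sgZ j k).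

Lemma levi_civita5C l m i j k :
  levi_civita5 m l i j k = - levi_civita5 l m i j k.
Proof. by rewrite /levi_civita5 (sgZC l m); ring. Qed.

Lemma levi_civita_symbolE (l m i j k : 'I_5) :
  levi_civita_symbol [tuple l; m; i; j; k] = (levi_civita5 l m i j k)%:~R :> R.
Proof.
rewrite /levi_civita_symbol /levi_civita5 !rmorphM/= -!sgZE.
under eq_bigr do rewrite big_mkcond /=.
rewrite !big_ord_recl !big_ord0 /= /bump /=.
by rewrite !(tnth_nth ord0) /= !mulr1 !mul1r !mulrA.
Qed.

Lemma skewE b i j : skew b -> b j i = - b i j.
Proof. by move=> /(congr1 (fun M : 'M[R]_5 => M i j)); rewrite !mxE. Qed.

Lemma skew_diag b i : skew b -> b i i = 0.
Proof. by move=> /(skewE i i) bi; lra. Qed.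

(* Identities between constant-coefficient forms are decided by evaluating their
   integer counterparts. *)
Definition int_form (x : nat -> nat -> int) : 'M[R]_5 :=
  \matrix_(i, j) (x i j)%:~R.

Definition wedge22Z (x y : nat -> nat -> int) (i j k l : nat) : int :=
  x i j * y k l - x i k * y j l + x i l * y j k
  + x j k * y i l - x j l * y i k + x k l * y i j.

Definition wedge_etaZ (x : nat -> nat -> int) (i j k : nat) : int :=
  (i == 4)%:Z * x j k + (j == 4)%:Z * x k i + (k == 4)%:Z * x i j.

(** The factor one half of [hodge2] is dropped to stay in the integers, so this is twice the Hodge
    operator. *)
Definition hodgeZ (x : nat -> nat -> int) (i j k : nat) : int :=
  \sum_(0 <= l < 5) \sum_(0 <= m < 5) x l m * levi_civita5 l m i j k.

Lemma wedge22_int_form x y (i j k l : 'I_5) :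
  wedge22 (int_form x) (int_form y) i j k l = (wedge22Z x y i j k l)%:~R.
Proof. by rewrite /wedge22 !mxE /wedge22Z; ring. Qed.

Lemma wedge_eta_int_form x (i j k : 'I_5) :
  wedge_eta (int_form x) i j k = (wedge_etaZ x i j k)%:~R.
Proof.
by rewrite /wedge_eta !mxE /wedge_etaZ /eta5 !rmorphD !rmorphM.
Qed.

Lemma hodge2_int_form x (i j k : 'I_5) :
  2 * hodge2 (int_form x) i j k = (hodgeZ x i j k)%:~R.
Proof.
rewrite /hodge2 mulVKf ?pnatr_eq0// /hodgeZ rmorph_sum big_mkord.
apply: eq_bigr => l _; rewrite rmorph_sum big_mkord; apply: eq_bigr => m _.
by rewrite mxE levi_civita_symbolE rmorphM.
Qed.

Lemma skew_lin k b b' : skew b -> skew b' -> skew (k *: b + b').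
Proof. by rewrite /skew linearP /= => -> ->; rewrite scalerN opprD. Qed.

Lemma skewD b b' : skew b -> skew b' -> skew (b + b').
Proof. by move=> sb sb'; rewrite -[b]scale1r; exact: skew_lin. Qed.

Lemma skewB b b' : skew b -> skew b' -> skew (b - b').
Proof. by move=> sb sb'; rewrite addrC -scaleN1r; exact: skew_lin. Qed.

Lemma hodge2_lin q b b' i j k :
  hodge2 (q *: b + b') i j k = q * hodge2 b i j k + hodge2 b' i j k.
Proof.
rewrite /hodge2 [q * _]mulrCA -mulrDr; congr (_ * _).
rewrite mulr_sumr -big_split/=.
apply: eq_bigr => l _; rewrite mulr_sumr -big_split/=; apply: eq_bigr => m _.
by rewrite !mxE mulrDl mulrA.
Qed.

Lemma wedge_eta_lin q b b' i j k :
  wedge_eta (q *: b + b') i j k = q * wedge_eta b i j k + wedge_eta b' i j k.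
Proof. by rewrite /wedge_eta !mxE; ring. Qed.

Lemma Lambda2_2_lin q b b' :
  Lambda2_2 b -> Lambda2_2 b' -> Lambda2_2 (q *: b + b').
Proof.
move=> [sb pb hb] [sb' pb' hb']; split; first exact: skew_lin.
- move=> i j k l.
  have <- : q * wedge22 Phi5 b i j k l + wedge22 Phi5 b' i j k l = 0.
    by rewrite pb pb' mulr0 addr0.
  by rewrite /wedge22; move: Phi5 => Phi; rewrite !mxE; ring.
- by move=> i j k; rewrite hodge2_lin wedge_eta_lin hb hb'.
Qed.

Lemma Lambda2_3_lin q b b' :
  Lambda2_3 b -> Lambda2_3 b' -> Lambda2_3 (q *: b + b').
Proof.
move=> [sb hb] [sb' hb']; split; first exact: skew_lin.
by move=> i j k; rewrite hodge2_lin wedge_eta_lin hb hb'; ring.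
Qed.

Lemma e2formE (k l : 'I_5) : e2form k l = int_form (e2formZ k l) :> 'M[R]_5.
Proof.
apply/matrixP => i j; rewrite !mxE rmorphB.
by case: (_ && _); case: (_ && _).
Qed.

Definition addZ (x y : nat -> nat -> int) i j := x i j + y i j.
Definition subZ (x y : nat -> nat -> int) i j := x i j - y i j.

Lemma int_formD x y : int_form x + int_form y = int_form (addZ x y).
Proof. by apply/matrixP => i j; rewrite !mxE rmorphD. Qed.

Lemma int_formB x y : int_form x - int_form y = int_form (subZ x y).
Proof. by apply/matrixP => i j; rewrite !mxE rmorphB. Qed.

Lemma skew_e2form (k l : 'I_5) : skew (e2form k l : 'M[R]_5).
Proof. by rewrite /skew linearB/= !trmx_delta opprB. Qed.

Lemma Lambda2_2_int_form x : skew (int_form x) ->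
  (forall i j k l : 'I_5, wedge22Z (addZ (e2formZ 0 1) (e2formZ 2 3)) x i j k l = 0) ->
  (forall i j k : 'I_5, hodgeZ x i j k = 2 * wedge_etaZ x i j k) ->
  Lambda2_2 (int_form x).
Proof.
move=> sx px hx; split=> // i j k; first move=> l.
  by rewrite /Phi5 !e2formE int_formD wedge22_int_form px.
have := hodge2_int_form x i j k; rewrite hx rmorphM/= -wedge_eta_int_form.
by apply: mulfI; rewrite pnatr_eq0.
Qed.

Lemma Lambda2_3_int_form x : skew (int_form x) ->
  (forall i j k : 'I_5, hodgeZ x i j k = - 2 * wedge_etaZ x i j k) ->
  Lambda2_3 (int_form x).
Proof.
move=> sx hx; split=> // i j k.
have := hodge2_int_form x i j k.
rewrite hx rmorphM/= -wedge_eta_int_form => h.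
have /mulfI : (2 : R) != 0 by rewrite pnatr_eq0.
apply; rewrite h; ring.
Qed.

(** On the orthogonal complement of [e_5], these are the self-dual forms orthogonal to [Phi5]; they
    make up [Lambda2_2]. *)
Definition self_dual s t : 'M[R]_5 :=
  s *: (e2form i1 i3 - e2form i2 i4) + t *: (e2form i1 i4 + e2form i2 i3).

Lemma Lambda2_2_0 : Lambda2_2 (0 : 'M[R]_5).
Proof.
split; first by rewrite /skew trmx0 oppr0.
- by move=> i j k l; rewrite /wedge22; move: Phi5 => P; rewrite !mxE; ring.
- move=> i j k; have := hodge2_lin (-1) 0 0 i j k.
  have := wedge_eta_lin (-1) 0 0 i j k.
  by rewrite scaleN1r addNr !mulN1r !addNr => -> ->.
Qed.

Lemma Lambda2_2_self_dual s t : Lambda2_2 (self_dual s t).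
Proof.
(* A trailing zero gives every summand the shape [q *: b + b'], which reduces the claim to the two
   basis forms. *)
rewrite /self_dual -[X in _ + X]addr0.
apply: Lambda2_2_lin; last (apply: Lambda2_2_lin; last exact: Lambda2_2_0).
- rewrite !e2formE int_formB; apply: Lambda2_2_int_form.
  + by rewrite -int_formB -!e2formE; apply: skewB; exact: skew_e2form.
  + by do 4!elim/ord5_ind.
  (* [unlock] exposes the iterated sums to [vm_compute], index by index. *)
  + by rewrite /hodgeZ unlock; do 3!elim/ord5_ind; vm_compute.
- rewrite !e2formE int_formD; apply: Lambda2_2_int_form.
  + by rewrite -int_formD -!e2formE; apply: skewD; exact: skew_e2form.
  + by do 4!elim/ord5_ind.
  + by rewrite /hodgeZ unlock; do 3!elim/ord5_ind; vm_compute.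
Qed.

(** The anti-self-dual forms on the orthogonal complement of [e_5]. *)
Definition anti_self_dual s t u : 'M[R]_5 :=
  s *: (e2form i1 i2 - e2form i3 i4) + (t *: (e2form i1 i3 + e2form i2 i4)
  + u *: (e2form i1 i4 - e2form i2 i3)).

Lemma Lambda2_3_0 : Lambda2_3 (0 : 'M[R]_5).
Proof.
have [s0 _ h0] := Lambda2_2_0; split=> // i j k; rewrite h0.
by rewrite /wedge_eta !mxE; ring.
Qed.

Lemma Lambda2_3_anti_self_dual s t u : Lambda2_3 (anti_self_dual s t u).
Proof.
rewrite /anti_self_dual -[X in _ + (_ + X)]addr0.
do 3?[apply: Lambda2_3_lin]; last exact: Lambda2_3_0.
- rewrite !e2formE int_formB; apply: Lambda2_3_int_form.
  + by rewrite -int_formB -!e2formE; apply: skewB; exact: skew_e2form.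
  + by rewrite /hodgeZ unlock; do 3!elim/ord5_ind; vm_compute.
- rewrite !e2formE int_formD; apply: Lambda2_3_int_form.
  + by rewrite -int_formD -!e2formE; apply: skewD; exact: skew_e2form.
  + by rewrite /hodgeZ unlock; do 3!elim/ord5_ind; vm_compute.
- rewrite !e2formE int_formB; apply: Lambda2_3_int_form.
  + by rewrite -int_formB -!e2formE; apply: skewB; exact: skew_e2form.
  + by rewrite /hodgeZ unlock; do 3!elim/ord5_ind; vm_compute.
Qed.

(** The form and the symbol are both skew in [(l, m)], so each unordered pair is counted twice,
    which absorbs the factor one half, and the diagonal vanishes. *)
Lemma hodge2E b (i j k : 'I_5) : skew b ->
  let h l m := b l m * (levi_civita5 l m i j k)%:~R in
  hodge2 b i j k =
  h i1 i2 + h i1 i3 + h i1 i4 + h i1 i5 + h i2 i3 + h i2 i4 + h i2 i5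
  + h i3 i4 + h i3 i5 + h i4 i5.
Proof.
move=> sb h.
have hC l m : h m l = h l m.
  by rewrite /h (skewE l m sb) levi_civita5C rmorphN mulrNN.
have hd l : h l l = 0 by rewrite /h skew_diag// mul0r.
rewrite /hodge2; under eq_bigr => l _ do under eq_bigr => m _ do
  rewrite levi_civita_symbolE -/(h l m).
rewrite !sum_ord5 !hd (hC i1 i2) (hC i1 i3) (hC i1 i4) (hC i1 i5) (hC i2 i3).
rewrite (hC i2 i4) (hC i2 i5) (hC i3 i4) (hC i3 i5) (hC i4 i5).
by clearbody h; field.
Qed.

Ltac eval_levi_civita5 := repeat match goal with |- context [levi_civita5 ?l ?m ?i ?j ?k] =>
  let v := eval vm_compute in (levi_civita5 l m i j k) in
  change (levi_civita5 l m i j k) with v end.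

(** These seven components suffice to exploit [*b = eta /\ b] or [*b = - eta /\ b]. Triples without
    the index 5 force the entries [b i i5] to vanish; triples with it relate complementary entries
    among the first four indices. *)
Lemma hodge2_123 b : skew b -> hodge2 b i1 i2 i3 = b i4 i5.
Proof. by move=> sb; rewrite hodge2E//=; eval_levi_civita5; ring. Qed.

Lemma hodge2_124 b : skew b -> hodge2 b i1 i2 i4 = - b i3 i5.
Proof. by move=> sb; rewrite hodge2E//=; eval_levi_civita5; ring. Qed.

Lemma hodge2_134 b : skew b -> hodge2 b i1 i3 i4 = b i2 i5.
Proof. by move=> sb; rewrite hodge2E//=; eval_levi_civita5; ring. Qed.

Lemma hodge2_234 b : skew b -> hodge2 b i2 i3 i4 = - b i1 i5.
Proof. by move=> sb; rewrite hodge2E//=; eval_levi_civita5; ring. Qed.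

Lemma hodge2_235 b : skew b -> hodge2 b i2 i3 i5 = b i1 i4.
Proof. by move=> sb; rewrite hodge2E//=; eval_levi_civita5; ring. Qed.

Lemma hodge2_245 b : skew b -> hodge2 b i2 i4 i5 = - b i1 i3.
Proof. by move=> sb; rewrite hodge2E//=; eval_levi_civita5; ring. Qed.

Lemma hodge2_345 b : skew b -> hodge2 b i3 i4 i5 = b i1 i2.
Proof. by move=> sb; rewrite hodge2E//=; eval_levi_civita5; ring. Qed.

Lemma skew_mxP b b' : skew b -> skew b' ->
  b i1 i2 = b' i1 i2 -> b i1 i3 = b' i1 i3 -> b i1 i4 = b' i1 i4 ->
  b i1 i5 = b' i1 i5 -> b i2 i3 = b' i2 i3 -> b i2 i4 = b' i2 i4 ->
  b i2 i5 = b' i2 i5 -> b i3 i4 = b' i3 i4 -> b i3 i5 = b' i3 i5 ->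
  b i4 i5 = b' i4 i5 -> b = b'.
Proof.
move=> sb sb' b12 b13 b14 b15 b23 b24 b25 b34 b35 b45.
have bC i j : b i j = b' i j -> b j i = b' j i.
  by rewrite (skewE i j sb) (skewE i j sb') => ->.
by apply/matrixP; do 2!elim/ord5_ind; rewrite ?skew_diag//; exact: bC.
Qed.

Lemma self_dualE s t (i j : 'I_5) : self_dual s t i j =
  s * ((e2formZ 0 2 i j)%:~R - (e2formZ 1 3 i j)%:~R)
  + t * ((e2formZ 0 3 i j)%:~R + (e2formZ 1 2 i j)%:~R).
Proof. by rewrite /self_dual !e2formE !mxE. Qed.

Lemma skew_Phi5 : skew (Phi5 : 'M[R]_5).
Proof. by apply: skewD; exact: skew_e2form. Qed.

(** The Hodge equation leaves the self-dual forms, in particular [b12 = b34]; the equation with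
    [Phi5] adds [b12 + b34 = 0], so both vanish. *)
Lemma Lambda2_2P b : Lambda2_2 b -> b = self_dual (b i1 i3) (b i1 i4).
Proof.
move=> [sb pb hb].
have := pb i1 i2 i3 i4; rewrite /wedge22 /Phi5 !e2formE !mxE /=; eval_e2formZ => p.
have := hb i1 i2 i3; rewrite hodge2_123// /wedge_eta /eta5 /= => h123.
have := hb i1 i2 i4; rewrite hodge2_124// /wedge_eta /eta5 /= => h124.
have := hb i1 i3 i4; rewrite hodge2_134// /wedge_eta /eta5 /= => h134.
have := hb i2 i3 i4; rewrite hodge2_234// /wedge_eta /eta5 /= => h234.
have := hb i2 i3 i5; rewrite hodge2_235// /wedge_eta /eta5 /= => h235.
have := hb i2 i4 i5; rewrite hodge2_245// /wedge_eta /eta5 /= => h245.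
have := hb i3 i4 i5; rewrite hodge2_345// /wedge_eta /eta5 /= => h345.
apply: skew_mxP => //; first by case: (Lambda2_2_self_dual (b i1 i3) (b i1 i4)).
all: rewrite self_dualE /=; eval_e2formZ.
all: clear pb hb sb; lra.
Qed.

Lemma Lambda2_4P b (i j : 'I_5) : Lambda2_4 b -> i != i5 -> j != i5 -> b i j = 0.
Proof.
move=> [_ wb] /negbTE ni /negbTE nj; have := wb i j i5.
by rewrite /wedge_eta /eta5 ni nj eqxx !mul0r !add0r mul1r.
Qed.

Lemma Lambda2_3P b : Lambda2_3 b ->
  [/\ b i2 i4 = b i1 i3, b i2 i3 = - b i1 i4 & forall i, b i i5 = 0].
Proof.
move=> [sb hb].
have := hb i1 i2 i3; rewrite hodge2_123// /wedge_eta /eta5 /= => h123.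
have := hb i1 i2 i4; rewrite hodge2_124// /wedge_eta /eta5 /= => h124.
have := hb i1 i3 i4; rewrite hodge2_134// /wedge_eta /eta5 /= => h134.
have := hb i2 i3 i4; rewrite hodge2_234// /wedge_eta /eta5 /= => h234.
have := hb i2 i3 i5; rewrite hodge2_235// /wedge_eta /eta5 /= => h235.
have := hb i2 i4 i5; rewrite hodge2_245// /wedge_eta /eta5 /= => h245.
have b55 := skew_diag i5 sb.
clear hb sb; split; [lra | lra | elim/ord5_ind; lra].
Qed.

(* The component of a skew matrix in [Lambda2_4]; the doubled entry [(i5, i5)]
   vanishes. *)
Definition eta_part b : 'M[R]_5 := \matrix_(i, j) ((eta5 i + eta5 j) * b i j).

Lemma Lambda2_4_eta_part b : skew b -> Lambda2_4 (eta_part b).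
Proof.
move=> sb; split.
  by apply/matrixP => i j; rewrite !mxE (skewE i j sb); ring.
move=> i j k; rewrite /wedge_eta !mxE.
(* Expanding leaves only products of two [eta5] factors. Such a product is nonzero only for
   [x = y = i5], where skewness of [b] cancels the bracket. *)
have diag (x y z : 'I_5) : eta5 x * eta5 y * (b y z + b z x) = 0 :> R.
  rewrite /eta5; case: eqVneq => [->|_]; case: eqVneq => [->|_]; rewrite ?(mul0r, mulr0)//.
  by rewrite (skewE i5 z sb) addrN mulr0.
rewrite -[RHS](addr0 0) -{1}(addr0 0) -{1}(diag i j k) -{1}(diag j k i) -{1}(diag k i j).
ring.
Qed.

(** The orthogonal projection of a skew matrix onto [Lambda2_2]. *)
Definition self_dual_part b : 'M[R]_5 :=
  self_dual ((b i1 i3 - b i2 i4) / 2) ((b i1 i4 + b i2 i3) / 2).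

(** Together with the equations of [u2P] these leave only zero in common, which makes the projection
    along [u2] unique. *)
Lemma u2_perpP b : u2_perp b ->
  skew b /\ [/\ b i1 i2 = 0, b i3 i4 = 0, b i2 i4 = - b i1 i3 & b i2 i3 = b i1 i4].
Proof.
move=> [b2 [b4 [L2 L4 ->]]]; split.
  by apply: skewD; [case: L2 | case: L4].
by rewrite !mxE !(Lambda2_4P L4)// (Lambda2_2P L2) !self_dualE /=; eval_e2formZ;
  split; ring.
Qed.

Lemma u2P b : u2 b ->
  skew b /\ [/\ b i2 i4 = b i1 i3, b i2 i3 = - b i1 i4 & forall i, b i i5 = 0].
Proof.
move=> [b1 [b3 [[t ->] L3 ->]]]; split.
  by apply: skew_lin; [exact: skew_Phi5 | case: L3].
have [b24 b23 bi5] := Lambda2_3P L3; rewrite /Phi5 !e2formE.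
split; [ | | elim/ord5_ind]; rewrite !mxE ?b24 ?b23 ?bi5 /=; eval_e2formZ; ring.
Qed.

Lemma u2_of b : skew b -> b i2 i4 = b i1 i3 -> b i2 i3 = - b i1 i4 ->
  (forall i, b i i5 = 0) -> u2 b.
Proof.
move=> sb b24 b23 bi5.
(* Half the sum of [b12] and [b34] is the [Phi5] coefficient, half their difference the coefficient
   of [e12 - e34]. *)
have L3 := Lambda2_3_anti_self_dual ((b i1 i2 - b i3 i4) / 2) (b i1 i3) (b i1 i4).
exists (((b i1 i2 + b i3 i4) / 2) *: Phi5); eexists; split; [by eexists | exact: L3 |].
apply: skew_mxP => //; first by apply: skew_lin; [exact: skew_Phi5 | case: L3].
all: rewrite /Phi5 /anti_self_dual !e2formE !mxE /=; eval_e2formZ;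
  by rewrite ?b24 ?b23 ?bi5; field.
Qed.

Definition u2_perp_part b : 'M[R]_5 := self_dual_part b + eta_part b.

Lemma u2_perp_partE b (i j : 'I_5) : u2_perp_part b i j =
  (b i1 i3 - b i2 i4) / 2 * ((e2formZ 0 2 i j)%:~R - (e2formZ 1 3 i j)%:~R)
  + (b i1 i4 + b i2 i3) / 2 * ((e2formZ 0 3 i j)%:~R + (e2formZ 1 2 i j)%:~R)
  + (eta5 i + eta5 j) * b i j.
Proof. by rewrite -self_dualE /u2_perp_part mxE [eta_part _ _ _]mxE. Qed.

Lemma skew_u2_perp_part b : skew b -> skew (u2_perp_part b).
Proof.
move=> sb; apply: skewD; last by case: (Lambda2_4_eta_part sb).
by case: (Lambda2_2_self_dual ((b i1 i3 - b i2 i4) / 2) ((b i1 i4 + b i2 i3) / 2)).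
Qed.

Lemma u2_sub_u2_perp_part b : skew b -> u2 (b - u2_perp_part b).
Proof.
move=> sb; have subE i j : (b - u2_perp_part b) i j = b i j - u2_perp_part b i j.
  by rewrite !mxE.
apply: u2_of; first by apply: skewB => //; exact: skew_u2_perp_part.
- by rewrite !subE !u2_perp_partE /eta5 /=; eval_e2formZ; field.
- by rewrite !subE !u2_perp_partE /eta5 /=; eval_e2formZ; field.
- have b55 := skew_diag i5 sb.
  elim/ord5_ind; rewrite !subE !u2_perp_partE /eta5 /=; eval_e2formZ; lra.
Qed.

(** [pr_u2_perp] chooses some solution. The explicit part shows that one exists, and the linear
    equations of [u2_perp] and [u2] determine its ten entries. *)
Lemma pr_u2_perpE b : skew b -> pr_u2_perp b = u2_perp_part b.
Proof.
move=> sb; have ex : exists c, u2_perp c /\ u2 (b - c).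
  exists (u2_perp_part b); split; last exact: u2_sub_u2_perp_part.
  exists (self_dual_part b), (eta_part b); split=> //.
    exact: Lambda2_2_self_dual.
  exact: Lambda2_4_eta_part.
have [cp cu] := getPex (ex : exists c, [set c | u2_perp c /\ u2 (b - c)] c).
rewrite /pr_u2_perp; move: (get _) cp cu => c cp cu.
have [sc [c12 c34 c24 c23]] := u2_perpP cp.
have [_ []] := u2P cu; rewrite !mxE => d24 d23 d5.
have := (d5 i1, d5 i2, d5 i3, d5 i4); rewrite !mxE => -[[[d15 d25] d35] d45].
apply: skew_mxP => //; first exact: skew_u2_perp_part.
all: rewrite !u2_perp_partE /eta5 /=; eval_e2formZ.
all: clear - c12 c34 c24 c23 d24 d23 d15 d25 d35 d45; lra.
Qed.

End TwoForms.

(** * The torsion of the frame *)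

Section TorsionClasses.
Context {R : realType}.
Variables a1 a2 a3 a4 : R.

(** The torsion identity is taken for the three cyclic permutations of the indices; by skewness all
    terms but two equal ones cancel. The inner products of an orthonormal frame are constant, hence
    no derivative terms. *)
Lemma koszul (I : Type) (Gam c : I -> I -> I -> R) :
  (forall i j k, Gam i j k = - Gam i k j) ->
  (forall i j k, Gam i j k - Gam j i k = c i j k) ->
  forall i j k, Gam i j k = (c i j k - c j k i + c k i j) / 2.
Proof.
move=> skewG torG i j k; rewrite -!torG (skewG i k j) (skewG k j i) (skewG j k i).
by field.
Qed.

(* [structure_coef A k i j] is [de_k(E_i, E_j)] when [A i] is [A2(E_i)]. *)
Definition structure_coef (A : 'I_5 -> R) (k i j : 'I_5) : R :=
  let w a b := ((a == i)%:R * (b == j)%:R - (a == j)%:R * (b == i)%:R : R) in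
  let wA b := A i * (b == j)%:R - A j * (b == i)%:R in
  match k : nat with
  | 0 => wA i2 - (2 * a1 + a3) * w i3 i5 - (2 * a2 + a4) * w i4 i5
  | 1 => - wA i1 + (2 * a1 + a3) * w i4 i5 - (2 * a2 + a4) * w i3 i5
  | 2 => - wA i4 + (2 * a1 + a3) * w i1 i5 + (2 * a2 + a4) * w i2 i5
  | 3 => wA i3 - (2 * a1 + a3) * w i2 i5 + (2 * a2 + a4) * w i1 i5
  | _ => - 2 * (a1 - a3) * (w i1 i3 - w i2 i4) - 2 * (a2 - a4) * (w i1 i4 + w i2 i3)
  end.

(** The value is that of [- de_5 / 2]: the vector field dual to [e_5] is Killing, and the terms in
    [A] cancel. *)
Lemma eta_connection_coef (A : 'I_5 -> R) (Gam : 'I_5 -> 'M[R]_5) :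
  (forall i j k, Gam i j k = - Gam i k j) ->
  (forall i j k, Gam i j k - Gam j i k = - structure_coef A k i j) ->
  forall i j, Gam i j i5 = self_dual (a1 - a3) (a2 - a4) i j.
Proof.
move=> sG tG i j; rewrite (koszul sG tG) self_dualE /structure_coef.
by move: i j; do 2!elim/ord5_ind; rewrite /=; eval_e2formZ; field.
Qed.

(** The terms in [A] are multiples of [e12 - e34] and do not meet these combinations; only the
    direction [e_5] contributes. *)
Lemma self_dual_connection_coef (A : 'I_5 -> R) (Gam : 'I_5 -> 'M[R]_5) :
  (forall i j k, Gam i j k = - Gam i k j) ->
  (forall i j k, Gam i j k - Gam j i k = - structure_coef A k i j) ->
  forall i, (Gam i i1 i3 - Gam i i2 i4) / 2 = eta5 i * (a1 + 2 * a3) /\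
            (Gam i i1 i4 + Gam i i2 i3) / 2 = eta5 i * (a2 + 2 * a4).
Proof.
move=> sG tG i; rewrite !(koszul sG tG) /structure_coef /eta5.
by move: i; elim/ord5_ind; rewrite /=; split; field.
Qed.

(** On [Lambda2_2] the Hodge operator is the wedge product with [eta]. For [b = self_dual a1 a2] and
    [b' = self_dual a3 a4] the right side is thus [eta_i (b + 2 b')_jk + eta_j (b - b')_ki + eta_k
    (b - b')_ij]: first the self-dual part of [Gam i], then its [eta] part. *)
Lemma pr_connection_coef (A : 'I_5 -> R) (Gam : 'I_5 -> 'M[R]_5) :
  (forall i j k, Gam i j k = - Gam i k j) ->
  (forall i j k, Gam i j k - Gam j i k = - structure_coef A k i j) ->
  forall i j k, pr_u2_perp (Gam i) j k =
    theta (self_dual a1 a2) i j k + vartheta (self_dual a3 a4) i j k.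
Proof.
move=> sG tG i j k.
have sGi : skew (Gam i) by apply/matrixP => x y; rewrite !mxE sG.
have [_ _ h1] := Lambda2_2_self_dual a1 a2.
have [_ _ h3] := Lambda2_2_self_dual a3 a4.
rewrite /theta /vartheta h1 h3 /wedge_eta pr_u2_perpE// u2_perp_partE.
have [-> ->] := self_dual_connection_coef sG tG i.
(* For [j = i5], skewness of [Gam i] moves the index 5 to the last slot, and the sign is absorbed by
   the order [k i]. *)
have -> : (eta5 j + eta5 k) * Gam i j k =
  eta5 j * self_dual (a1 - a3) (a2 - a4) k i + eta5 k * self_dual (a1 - a3) (a2 - a4) i j.
  rewrite (skewE i k); last by case: (Lambda2_2_self_dual (a1 - a3) (a2 - a4)).
  rewrite -!(eta_connection_coef sG tG) -sG mulrDl /eta5.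
  by congr (_ + _); case: eqP => [->|]; rewrite ?mul0r ?mul1r.
rewrite !self_dualE; ring.
Qed.

Lemma torsion_classes (T : 'I_5 -> 'I_5 -> 'I_5 -> R) :
  (forall i j k, T i j k =
    theta (self_dual a1 a2) i j k + vartheta (self_dual a3 a4) i j k) ->
  [/\ W4_plus_W7 T, W4 T <-> a3 = 0 /\ a4 = 0 & W7 T <-> a1 = 0 /\ a2 = 0].
Proof.
move=> TE.
have L1 := Lambda2_2_self_dual a1 a2; have L3 := Lambda2_2_self_dual a3 a4.
have [_ _ h1] := L1; have [_ _ h3] := L3.
(* These are [T135 = a1 - a3] and [T513 = a1 + 2 a3], likewise with [a2], [a4] for the index 4.
   Membership in [W4] forces [T513 = T135], membership in [W7] forces [T513 = - 2 T135]. *)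
have T135 := TE i1 i3 i5; have T513 := TE i5 i1 i3.
have T145 := TE i1 i4 i5; have T514 := TE i5 i1 i4.
move: T135 T513 T145 T514; rewrite /theta /vartheta !h1 !h3 /wedge_eta !self_dualE /eta5 /=.
eval_e2formZ => T135 T513 T145 T514.
have self_dual00 : self_dual 0 0 = 0 :> 'M[R]_5.
  by rewrite /self_dual !scale0r addr0.
split.
- exists (theta (self_dual a1 a2)), (vartheta (self_dual a3 a4)); split=> //.
    by exists (self_dual a1 a2).
  by exists (self_dual a3 a4).
- split=> [[b [Lb Tb]] | [a30 a40]].
    have [_ _ hb] := Lb; move: T135 T513 T145 T514.
    rewrite !Tb /theta !hb /wedge_eta /eta5 /=.
    clear; move=> *; split; lra.
  exists (self_dual a1 a2); split=> // i j k; rewrite TE /vartheta h3.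
  by rewrite a30 a40 self_dual00 /wedge_eta !mxE; ring.
- split=> [[b [Lb Tb]] | [a10 a20]].
    have [_ _ hb] := Lb; move: T135 T513 T145 T514.
    rewrite !Tb /vartheta !hb /wedge_eta /eta5 /=.
    clear; move=> *; split; lra.
  exists (self_dual a3 a4); split=> // i j k; rewrite TE /theta h1.
  by rewrite a10 a20 self_dual00 /wedge_eta !mxE; ring.
Qed.

End TorsionClasses.

Lemma ext_d_structure (R : realType) (a1 a2 a3 a4 : R) (G : lie_group R 6)
    (e : 'I_5 -> G -> 'rV[R]_6 -> R) (A2 : G -> 'rV[R]_6 -> R)
    (x : G) (u : 'I_5 -> 'rV[R]_6) (i j k : 'I_5) :
  structure_equations a1 a2 a3 a4 e A2 ->
  (forall i j, e i x (u j) = (i == j)%:R) ->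
  ext_d (e k) x (u i) (u j) = structure_coef a1 a2 a3 a4 (fun l => A2 x (u l)) k i j.
Proof.
move=> /(_ x (u i) (u j)) [d1 d2 d3 [d4 d5 _]] eu.
by elim/ord5_ind: k; rewrite ?(d1, d2, d3, d4, d5) /wedge !eu /structure_coef /=; ring.
Qed.

(** * The Levi-Civita connection in an orthonormal frame *)

Section OrthonormalFrame.
Context {R : realType} {M : manifold R 5}.
Variable g : M -> 'rV[R]_5 -> 'rV[R]_5 -> R.
Variable nabla : (M -> 'rV[R]_5) -> (M -> 'rV[R]_5) -> (M -> 'rV[R]_5).
Variable E : 'I_5 -> M -> 'rV[R]_5.
Hypothesis gM : is_metric g.
Hypothesis nablaLC : is_levi_civita g nabla.
Hypothesis ES : forall i, smooth_vfield (E i).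
Hypothesis EO : forall p i j, g p (E i p) (E j p) = (i == j)%:R.

Lemma connection_matrix_skew p i j k :
  connection_matrix g nabla E p i j k = - connection_matrix g nabla E p i k j.
Proof.
have [_ gC _ _] := gM; have [_ _ gD] := nablaLC.
rewrite !mxE; apply/eqP; rewrite -subr_eq0 opprK; apply/eqP.
rewrite [X in _ + X]gC -gD//.
have -> : (fun q => g q (E j q) (E k q)) = cst (j == k)%:R.
  by apply/funext => q; rewrite EO.
exact: derive_cst.
Qed.

Lemma connection_matrix_torsion p i j k :
  connection_matrix g nabla E p i j k - connection_matrix g nabla E p j i k =
  g p (E k p) (lie_bracket (E i) (E j) p).
Proof.
have [gl gC _ _] := gM; have [_ tD _] := nablaLC.
rewrite !mxE -tD// [RHS]gC addrC -mulN1r -gl scaleN1r.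
by rewrite [- _ + _]addrC.
Qed.

End OrthonormalFrame.

Theorem corollary5p1 (R : realType) (a1 a2 a3 a4 : R) (ha : a1 * a4 = a2 * a3)
  (G : lie_group R 6) (e : 'I_5 -> G -> 'rV[R]_6 -> R) (A2 : G -> 'rV[R]_6 -> R)
  (hbasis : is_left_invariant_basis e A2)
  (hstruct : structure_equations a1 a2 a3 a4 e A2)
  (M : manifold R 5) (hM : [set: M] !=set0) (iota : M -> G)
  (hiota : is_submanifold iota)
  (hindep : forall (p : M) (c : 'I_5 -> R),
     (forall v, \sum_(i < 5) c i * pullback iota (e i) p v = 0) ->
     forall i, c i = 0)
  (g : M -> 'rV[R]_5 -> 'rV[R]_5 -> R) (xi : M -> 'rV[R]_5)
  (eta : M -> 'rV[R]_5 -> R) (phi : M -> 'rV[R]_5 -> 'rV[R]_5)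
  (hacm : is_almost_contact_metric g xi eta phi)
  (E : 'I_5 -> M -> 'rV[R]_5) (hE : is_adapted_frame g eta phi E)
  (hEe : forall i p v, g p (E i p) v = pullback iota (e i) p v)
  (nabla : (M -> 'rV[R]_5) -> (M -> 'rV[R]_5) -> (M -> 'rV[R]_5))
  (hnabla : is_levi_civita g nabla) :
  [/\ of_class W4_plus_W7 g nabla E,
      of_class W4 g nabla E <-> a3 = 0 /\ a4 = 0 &
      of_class W7 g nabla E <-> a1 = 0 /\ a2 = 0].
Proof.
have [gM _ _ _ _] := hacm; have [ES EO _ _] := hE.
have [iotaS _ _] := hiota; have [eL _ _] := hbasis.
(* The pulled back forms are constant on the frame, as [pullback_lie_bracket] requires. *)
have eE i j q : pullback iota (e i) q (E j q) = (i == j)%:R by rewrite -hEe.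
have classes p : [/\ W4_plus_W7 (intrinsic_torsion g nabla E p),
    W4 (intrinsic_torsion g nabla E p) <-> a3 = 0 /\ a4 = 0 &
    W7 (intrinsic_torsion g nabla E p) <-> a1 = 0 /\ a2 = 0].
  apply: torsion_classes => i j k.
  apply: (pr_connection_coef (A := fun l => A2 (iota p) (mdiff iota p (E l p)))).
    exact: connection_matrix_skew.
  move=> {}i {}j {}k; rewrite connection_matrix_torsion// hEe.
  have [eF _] := eL k.
  rewrite (pullback_lie_bracket iotaS eF p (ES i) (ES j) (eE k i) (eE k j)).
  congr (- _); apply: (ext_d_structure (u := fun l => mdiff iota p (E l p)) _ _ _ hstruct).
  by move=> x y; exact: eE.
(* The conditions on the constants are read off at one point, since [of_class] would hold vacuously
   on an empty manifold. *)
have [p0 _] := hM; have [_ W4p W7p] := classes p0.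
split; first by move=> p; have [] := classes p.
- split=> [/(_ p0)/W4p //| a34 p]; have [_ W4q _] := classes p; exact/W4q.
- split=> [/(_ p0)/W7p //| a12 p]; have [_ _ W7q] := classes p; exact/W7q.
Qed.
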